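(* Let $d\ge 2$ and $n,k\ge 0$ be integers. Then $N_d(n,k)$ equals the number of labelled Dyck paths in $\widetilde{\mathcal{Q}}_d$ with semilength $n+1$ and exactly $k$ instances of $UU$.
   Context: $N_d(n,k) = \frac{1}{n+1} \binom{n+1}{k+1} \binom{ n + (n-k)(d-2)+1}{k}$. A Dyck path is a lattice path from $(0,0)$ with up steps $U=(1,1)$ and down steps $D=(1,-1)$, never going below the $x$-axis and ending on it at $(2m,0)$; $m$ is its semilength. A descent is a maximal run of consecutive down steps. $\widetilde{\mathcal{Q}}_d$ is the set of pairs consisting of a nonempty Dyck path together with a labelling in which the last descent is unlabelled and every other descent, of length $\ell\ge 1$, is labelled by a composition of $\ell-1$ into $d-1$ nonnegative parts. An instance of $UU$ is a position where an up step is immediately followed by an up step. *)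

(* Defs.v *)
From mathcomp Require Import all_boot all_order all_algebra.
From mathcomp Require Import finmap.

Set Implicit Arguments.
Unset Strict Implicit.
Unset Printing Implicit Defensive.

Import Order.TTheory GRing.Theory Num.Theory.
Local Open Scope ring_scope.

(* For k > n the truncated difference n - k is harmless: 'C(n.+1, k.+1) = 0. *)
Definition Nnum (d n k : nat) : rat :=
  (n.+1%:R)^-1 * 'C(n.+1, k.+1)%:R * 'C(n + (n - k) * (d - 2) + 1, k)%:R.

(* A lattice path is its sequence of steps: U = (1,1), D = (1,-1). *)
Notation step := bool (only parsing).
Definition U : step := true.
Definition D : step := false.

Definition height (w : seq step) : int :=
  \sum_(s <- w) (if s == U then 1 else -1).

Definition dyck (w : seq step) : bool :=
  all (fun i => 0 <= height (take i w)) (iota 0 (size w).+1)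
  && (height w == 0).

(* A Dyck path ends at (size w, 0) = (2m, 0), where m is the semilength. *)
Definition semilength (w : seq step) : nat := (size w)./2.

(* Lengths of the maximal runs of D, from left to right; r is the length of
   the run being read. *)
Fixpoint descents_from (r : nat) (w : seq step) : seq nat :=
  match w with
  | [::] => if r == 0%N then [::] else [:: r]
  | s :: w' =>
      if s == D then descents_from r.+1 w'
      else if r == 0%N then descents_from 0 w'
      else r :: descents_from 0 w'
  end.

Definition descents (w : seq step) : seq nat := descents_from 0 w.

Definition nb_UU (w : seq step) : nat :=
  count (fun i => (nth D w i == U) && (nth D w i.+1 == U))
        (iota 0 (size w).-1).

Definition composition (l m : nat) (c : seq nat) : bool :=
  (size c == m) && (sumn c == l).

(* A path together with the labels of its descents other than the last one,
   listed from left to right. *)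
Notation labelled_path := (seq step * seq (seq nat))%type (only parsing).

(* all2 also requires both lists to have the same length. *)
Definition Qtilde (d : nat) : pred labelled_path := fun p =>
  [&& p.1 != [::], dyck p.1 &
      all2 (fun l c => composition l.-1 d.-1 c)
           (take (size (descents p.1)).-1 (descents p.1)) p.2].

(* Main.v *)
Require Import Defs.
From mathcomp Require Import all_boot all_order all_algebra.
From mathcomp Require Import finmap zify ring.

(** Cutting a path of semilength [n+1] before each up step gives [n+1] blocks
    [U D^r]. The last block is unlabelled and its [r] is forced; the first [n]
    form a word over the steps [None] (the block [U]) and [Some c] (the block
    [U D^(1 + |c|)] with label [c]), which changes the height by [1], resp.
    [- |c|], so the labelled path is recovered from a word that stays
    nonnegative, and [UU] counts the letters [None]. By a cycle-lemma type
    formula, proved here by induction on the last letter, the number of such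
    words with [k] letters [None] that end at height [e] is
    [(e+1)/(n+1) C(n+1,k+1) [x^(k-e)] (1-x)^(-(n-k)(d-1))];
    as [\sum_e (e+1) x^e = (1-x)^(-2)], summing over [e] gives
    [1/(n+1) C(n+1,k+1) [x^k] (1-x)^(-(n-k)(d-1)-2)]. *)

Set Implicit Arguments.
Unset Strict Implicit.
Unset Printing Implicit Defensive.

Import Order.TTheory GRing.Theory Num.Theory.

(** * Compositions into nonnegative parts *)

(* The coefficient of [x^j] in [(1-x)^(-p)]; truncation makes it [j == 0] for
   [p = 0]. *)
Definition ncomp (p j : nat) : nat := 'C((p + j).-1, j).

Lemma ncomp0 p : ncomp p 0 = 1.
Proof. by rewrite /ncomp bin0. Qed.

Lemma ncomp0S j : ncomp 0 j.+1 = 0.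
Proof. by rewrite /ncomp add0n bin_small. Qed.

Lemma ncomp2 j : ncomp 2 j = j.+1.
Proof. by rewrite /ncomp binSn. Qed.

Lemma ncompSS p j : ncomp p.+1 j.+1 = ncomp p.+1 j + ncomp p j.+1.
Proof. by rewrite /ncomp !addSn !addnS /= binS addnC. Qed.

(** Coefficient form of the derivative of [(1-x)^(-p)], which is [p (1-x)^(-p-1)]. *)
Lemma mul_ncomp p j : j.+1 * ncomp p j.+1 = p * ncomp p.+1 j.
Proof.
case: p => [|p]; first by rewrite ncomp0S muln0.
by rewrite /ncomp !addSn !addnS /= mul_bin_left subSn ?leq_addl // addnK.
Qed.

(** Compares coefficients in [(1-x)^(-p) (1-x)^(-q) = (1-x)^(-(p+q))]. *)
Lemma ncomp_conv p q n :
  \sum_(j < n.+1) ncomp p j * ncomp q (n - j) = ncomp (p + q) n.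
Proof.
elim: p n => [|p IHp] n.
  by rewrite big_ord_recl /= ncomp0 subn0 mul1n big1 ?addn0 // => j _;
     rewrite /bump ncomp0S.
elim: n => [|n IHn]; first by rewrite big_ord1 !ncomp0.
rewrite addSn ncompSS -addSn -IHn -IHp big_ord_recl [X in _ = _ + X]big_ord_recl.
rewrite /= !ncomp0 addnCA; congr (_ + _); rewrite -big_split /=.
by apply: eq_bigr => j _; rewrite /bump /= !add1n subSS ncompSS mulnDl.
Qed.

(** With [f = (1-x)^(-p)] and [g = (1-x)^(-q)], both [(p+q) x f' g] and [p x (f g)'] equal
    [p (p+q) x (1-x)^(-p-q-1)]. *)
Lemma ncomp_conv_index p q n :
  (p + q) * (\sum_(j < n.+1) j * ncomp p j * ncomp q (n - j)) =
  p * (n * ncomp (p + q) n).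
Proof.
case: n => [|n]; first by rewrite big_ord1 mul0n !muln0.
rewrite big_ord_recl /= mul0n add0n mul_ncomp -addSn mulnCA; congr (_ * _).
rewrite -ncomp_conv big_distrr /=; apply: eq_bigr => j _.
by rewrite /bump add1n mul_ncomp subSS mulnA.
Qed.

Fixpoint compositions (p j : nat) : seq (seq nat) :=
  if p is p'.+1 then
    [seq x :: c | x <- iota 0 j.+1, c <- compositions p' (j - x)]
  else if j == 0 then [:: [::]] else [::].

Lemma compositionsS p j :
  compositions p.+1 j =
  [seq x :: c | x <- iota 0 j.+1, c <- compositions p (j - x)].
Proof. by []. Qed.

Lemma mem_compositions p j c : (c \in compositions p j) = composition j p c.
Proof.
elim: p j c => [|p IH] j c.
  rewrite /composition /=; case: j => [|j] /=.
    by rewrite inE; case: c => [|x c].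
  by rewrite in_nil; case: c => [|x c].
rewrite compositionsS; apply/allpairsPdep/idP => [[x [c' [+ + ->]]]|].
  rewrite mem_iota IH /composition /= add0n eqSS ltnS => lexj /andP[-> /eqP->].
  by rewrite /= subnKC ?eqxx.
case: c => [|x c]; first by [].
rewrite /composition /= eqSS => /andP[szc /eqP sumc].
have xj : x \in iota 0 j.+1 by rewrite mem_iota; lia.
exists x, c; split; [exact: xj| |by []].
by rewrite IH /composition szc -sumc addKn /=.
Qed.

Lemma compositions_uniq p j : uniq (compositions p j).
Proof.
elim: p j => [|p IH] j; first by case: j.
rewrite compositionsS; apply: allpairs_uniq_dep => [|x _|].
- exact: iota_uniq.
- exact: IH.
by move=> [x c] [x' c'] _ _ /= [-> ->].
Qed.

Lemma size_allpairs_sum (S T V : Type) (f : S -> T -> V) (s : seq S)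
    (t : S -> seq T) :
  size [seq f x y | x <- s, y <- t x] = \sum_(x <- s) size (t x).
Proof. by rewrite size_allpairs_dep sumnE big_map. Qed.

Lemma size_compositions p j : size (compositions p j) = ncomp p j.
Proof.
elim: p j => [|p IH] j; first by case: j => [|j] //=; rewrite ncomp0S.
rewrite compositionsS size_allpairs_sum -[iota 0 _]/(index_iota 0 j.+1).
rewrite big_mkord -(add1n p) -ncomp_conv; apply: eq_bigr => x _.
by rewrite IH /ncomp add1n binn mul1n.
Qed.

(** * Words of blocks *)

Section Words.

Variable p : nat.

Definition block := option (seq nat).

Fixpoint valid_word (h : nat) (s : seq block) : bool :=
  match s with
  | [::] => true
  | None :: s' => valid_word h.+1 s'
  | Some c :: s' => [&& size c == p, sumn c <= h & valid_word (h - sumn c) s']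
  end.

(* [rev_word h t e]: the reversal of [t] leads from height [h] to [e]. *)
Fixpoint rev_word (h : nat) (t : seq block) (e : nat) : bool :=
  match t with
  | [::] => e == h
  | None :: t' => (0 < e) && rev_word h t' e.-1
  | Some c :: t' => (size c == p) && rev_word h t' (e + sumn c)
  end.

Lemma rev_word_rcons_None h t e :
  rev_word h (rcons t None) e = rev_word h.+1 t e.
Proof.
elim: t e => [|[c|] t IH] e /=; last by rewrite IH.
  by case: e.
by rewrite IH.
Qed.

Lemma rev_word_rcons_Some h t c e :
  rev_word h (rcons t (Some c)) e =
  [&& size c == p, sumn c <= h & rev_word (h - sumn c) t e].
Proof.
elim: t e => [|[c'|] t IH] e /=; last by rewrite IH; do !bool_congr.
  by congr (_ && _); lia.
by rewrite IH; do !bool_congr.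
Qed.

Lemma valid_wordP h s :
  (exists e, rev_word h (rev s) e) <-> valid_word h s.
Proof.
elim: s h => [|[c|] s IH] h /=.
- by split=> // _; exists h; rewrite /= eqxx.
- rewrite rev_cons; split=> [[e]|].
    by rewrite rev_word_rcons_Some => /and3P[-> -> He] /=; apply/IH; exists e.
  case/and3P=> szc lec /IH[e He]; exists e.
  by rewrite rev_word_rcons_Some szc lec.
- rewrite rev_cons; split=> [[e]|/IH[e He]].
    by rewrite rev_word_rcons_None => He; apply/IH; exists e.
  by exists e; rewrite rev_word_rcons_None.
Qed.

(** The end height is a function of the word, so the lists for different [e] will be disjoint. *)
Lemma rev_word_inj h t e e' : rev_word h t e -> rev_word h t e' -> e = e'.
Proof.
elim: t e e' => [|[c|] t IH] e e' /=; first by move=> /eqP-> /eqP->.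
  by case/andP=> _ He /andP[_ /(IH _ _ He)]; apply: addIn.
by case: e => // e /=; case: e' => // e' /= He /(IH _ _ He) ->.
Qed.

(** Only [None] raises the height, and by one each time. *)
Lemma rev_word_le t e : rev_word 0 t e -> e <= count_mem None t.
Proof.
elim: t e => [|[c|] t IH] e /=; first by move/eqP->.
  by case/andP=> _ /IH; apply: leq_trans; rewrite leq_addr.
by case: e => // e /= /IH.
Qed.

(** Words are stored reversed, so a cons adds the last letter: before it the height was [e - 1] for
    [None] and [e + j] for a label of sum [j]. Restricting to [j <= k - e] loses nothing by
    [rev_word_le]. *)
Fixpoint words (n k e : nat) : seq (seq block) :=
  if n is n'.+1 then
    (if k is k'.+1 then
       if e is e'.+1 then [seq None :: t | t <- words n' k' e'] else [::]
     else [::])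
    ++ [seq u | j <- iota 0 (k.+1 - e),
                u <- [seq Some c :: t | c <- compositions p j,
                                        t <- words n' k (e + j)]]
  else if (k == 0) && (e == 0) then [:: [::]] else [::].

Lemma mem_words n k e t :
  (t \in words n k e) = [&& size t == n, count_mem None t == k & rev_word 0 t e].
Proof.
elim: n k e t => [|n IH] k e t.
  case: t => [|b t] /=.
    by rewrite eq_sym; case: k => [|k]; case: e.
  by case: ifP.
rewrite [words _ _ _]/= mem_cat; case: t => [|[c|] t].
- apply/negbTE; rewrite negb_or; apply/andP; split.
    by case: k => // k; case: e => // e; apply/negP => /mapP[].
  by apply/negP => /allpairsPdep[j [u [_ /allpairsPdep[c [t [_ _ ->]]]]]].
- set A := (X in X || _); have ->: A = false.
    rewrite {}/A; case: k => // k; case: e => // e.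
    by apply/negP => /mapP[].
  rewrite /= eqSS; apply/allpairsPdep/idP.
    case=> [j [u [_ /allpairsPdep[c' [t' [+ + ->]]] [-> ->]]]].
    by rewrite mem_compositions IH => /andP[-> /eqP->].
  case/and4P=> szt ct szc He; exists (sumn c), (Some c :: t); split=> //.
    rewrite mem_iota; have := rev_word_le He; move/eqP: ct; rewrite add0n.
    by move=> ->; lia.
  apply/allpairsPdep; exists c, t; split=> //.
    by rewrite mem_compositions /composition szc /=.
  by rewrite IH szt ct.
- set B := (X in _ || X); have ->: B = false.
    by apply/negP => /allpairsPdep[j [u [_ /allpairsPdep[c [t' [_ _ ->]]]]]].
  rewrite orbF /= eqSS add1n {B}; case: k => [|k]; first by rewrite andbF.
  case: e => [|e]; first by rewrite !andbF.
  by rewrite eqSS -IH mem_map // => ? ? [].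
Qed.

Lemma words_uniq n k e : uniq (words n k e).
Proof.
elim: n k e => [|n IH] k e; first by rewrite /=; case: ifP.
rewrite [words _ _ _]/= cat_uniq; apply/and3P; split.
- by case: k => // k; case: e => // e; rewrite map_inj_uniq // => ? ? [].
- apply/hasPn => u /allpairsPdep[j [_ [_ /allpairsPdep[c [t [_ _ ->]]] ->]]].
  by case: k => // k; case: e => // e; apply/negP => /mapP[].
- apply: allpairs_uniq_dep => [|j _|].
  + exact: iota_uniq.
  + apply: allpairs_uniq => [||[c t] [c' t'] _ _ /= [-> ->]] //.
      exact: compositions_uniq.
  + move=> [j u] [j' u'] /allpairsPdep[j1 [u1 [_ + [Ej Eu]]]].
    rewrite {}Ej {}Eu => /allpairsPdep[c [t [Hc _ ->]]].
    move=> /allpairsPdep[j2 [u2 [_ + [Ej Eu]]]].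
    rewrite {}Ej {}Eu => /allpairsPdep[c' [t' [Hc' _ ->]]] /= [Ec ->].
    move: Hc Hc'; rewrite !mem_compositions Ec.
    by move=> /andP[_ /eqP<-] /andP[_ /eqP<-].
Qed.

(** * The closed formula for the number of words *)

Lemma size_wordsS n k e :
  size (words n.+1 k e) =
  (if k is k'.+1 then if e is e'.+1 then size (words n k' e') else 0 else 0)
  + \sum_(j < k.+1 - e) ncomp p j * size (words n k (e + j)).
Proof.
rewrite [words _ _ _]/= size_cat; congr (_ + _).
  by case: k => // k; case: e => // e; rewrite size_map.
have ->: iota 0 (k.+1 - e) = index_iota 0 (k.+1 - e).
  by rewrite /index_iota subn0.
rewrite size_allpairs_sum big_mkord.
by apply: eq_bigr => j _; rewrite size_allpairs size_compositions.
Qed.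

Hypothesis p_gt0 : 0 < p.

Lemma size_words n k e :
  n.+1 * size (words n k e) =
  if e <= k then e.+1 * 'C(n.+1, k.+1) * ncomp ((n - k) * p) (k - e) else 0.
Proof.
elim: n k e => [|n IH] k e.
  case: k => [|k]; first by case: e.
  by rewrite /= muln0 bin_small // muln0; case: ifP.
(* Words ending with [None]: the induction hypothesis at [k - 1], [e - 1]. The factor [e] makes the
   formula vanish at [e = 0], where no such word exists. *)
have Hfirst : n.+1 * (if k is k'.+1 then
      if e is e'.+1 then size (words n k' e') else 0 else 0) =
    if e <= k then e * 'C(n.+1, k) * ncomp ((n.+1 - k) * p) (k - e) else 0.
  case: k => [|k]; first by case: e => [|e] //=; rewrite muln0.
  by case: e => [|e]; [rewrite muln0 | rewrite IH ltnS !subSS].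
rewrite size_wordsS; apply/eqP; rewrite -(eqn_pmul2l (ltn0Sn n)); apply/eqP.
rewrite mulnCA [n.+1 * (_ + _)]mulnDr {}Hfirst.
case: leqP => [le_ek|lt_ke]; last first.
  by rewrite (eqP (_ : k.+1 - e == 0)) ?subn_eq0 // big_ord0 !muln0.
(* The factor [e + j + 1] of the induction hypothesis is split into [e + 1] and [j], giving one sum
   for [ncomp_conv] and one for [ncomp_conv_index]. *)
have ->: n.+1 * (\sum_(j < k.+1 - e) ncomp p j * size (words n k (e + j))) =
    'C(n.+1, k.+1) * (\sum_(j < (k - e).+1)
       (e.+1 * (ncomp p j * ncomp ((n - k) * p) (k - e - j)) +
        j * ncomp p j * ncomp ((n - k) * p) (k - e - j))).
  rewrite subSn // !big_distrr /=; apply: eq_bigr => j _.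
  rewrite mulnCA IH (_ : e + j <= k); last by have := ltn_ord j; lia.
  by rewrite subnDA; ring.
rewrite big_split /= -big_distrr /= ncomp_conv.
set N := k - e; set X := \sum_(j < _) _.
have Hk : n.+2 * 'C(n.+1, k) = k.+1 * 'C(n.+2, k.+1) by rewrite mul_bin_diag.
case: (leqP k n) => [le_kn|lt_nk].
  have Hq : n.+2 * 'C(n.+1, k.+1) = (n.+1 - k) * 'C(n.+2, k.+1).
    by rewrite (mul_bin_down n.+2) subSS.
  have Ep : p + (n - k) * p = (n.+1 - k) * p by rewrite subSn // mulSn.
  (* Here [p + q] is the multiple [(n + 1 - k) p] of [p], so the positive factor [p] cancels in
     [ncomp_conv_index]. *)
  have HX : (n.+1 - k) * X = N * ncomp ((n.+1 - k) * p) N.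
    apply/eqP; rewrite -(eqn_pmul2l p_gt0); apply/eqP.
    by rewrite -Ep -ncomp_conv_index -/X Ep; ring.
  rewrite Ep; set c := ncomp _ _ in HX *.
  set B := 'C(n.+2, _) in Hk Hq *.
  transitivity (e * (n.+2 * 'C(n.+1, k)) * c +
     (n.+2 * 'C(n.+1, k.+1)) * (e.+1 * c + X)); first by ring.
  rewrite Hk Hq.
  transitivity (B * (e * k.+1 * c + (n.+1 - k) * e.+1 * c + (n.+1 - k) * X)).
    by ring.
  rewrite HX -!mulnDl mulnA [RHS]mulnA; congr (_ * _).
  rewrite mulnCA mulnC mulnA; congr (_ * _).
  (* Replacing the truncated differences by [q] and [N'] leaves the polynomial identity [e(k+1) +
     (n+1-k)(e+1) + (k-e) = (n+1)(e+1)]. *)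
  have [q Eq] : exists q, n.+1 = k + q by exists (n.+1 - k); lia.
  have [N' EN] : exists N', k = e + N' by exists (k - e); lia.
  by rewrite /N Eq addKn EN addKn; ring.
(* For [k > n] only the words made of [None] alone survive, that is [k = e = n + 1]. *)
rewrite ['C(n.+1, k.+1)]bin_small // mul0n addn0.
rewrite (eqP (_ : n.+1 - k == 0)) ?subn_eq0 // mul0n.
case: (ltngtP k n.+1) lt_nk => // [lt_nk|Ek] _.
  by rewrite !bin_small // !muln0.
rewrite {}/X /N; case: (ltngtP e k) le_ek => // [lt_ek|->] _.
  by rewrite -(subnSK lt_ek) ncomp0S !muln0.
by rewrite Ek subnn ncomp0 !binn; ring.
Qed.

End Words.

(** * Labelled paths *)

Fixpoint dyck_from (h : nat) (w : seq bool) : bool :=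
  match w with
  | [::] => h == 0
  | true :: w' => dyck_from h.+1 w'
  | false :: w' => if h is h'.+1 then dyck_from h' w' else false
  end.

Lemma height_cons b w :
  height (b :: w) = ((if b then 1 else -1) + height w)%R.
Proof. by rewrite /height big_cons eqb_id. Qed.

(** An arbitrary starting height [h] makes the induction on the path possible. *)
Lemma dyck_fromE h w :
  all (fun i => (0 <= h%:Z + height (take i w))%R) (iota 0 (size w).+1)
  && (h%:Z + height w == 0)%R = dyck_from h w.
Proof.
elim: w h => [|b w IH] h; first by rewrite /= /height big_nil addr0 /=; lia.
have ->: iota 0 (size (b :: w)).+1 = 0 :: [seq i.+1 | i <- iota 0 (size w).+1].
  by rewrite -(iotaDl 1).
rewrite [all _ _]/= -[X in (0 <= _ + height X)%R]/[::] all_map.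
rewrite {1}/height big_nil addr0 (_ : (0 <= h%:Z)%R) //= height_cons.
case: b => [|]; last case: h => [|h].
- rewrite -IH /= take0 height_cons; congr (_ && _ && _); first 1 last.
  + by apply: eq_all => i /=; rewrite height_cons addrA intS (addrC 1%R).
  + by rewrite addrA intS (addrC 1%R).
  + by rewrite addrA intS (addrC 1%R).
- by rewrite take0 height_cons /height big_nil.
- rewrite -IH /= take0 height_cons.
  have E x : (h.+1%:Z + (- 1 + x) = h%:Z + x)%R by rewrite intS; ring.
  rewrite !E; congr (_ && _ && _).
  by apply: eq_all => i /=; rewrite height_cons E.
Qed.

Lemma dyckE w : dyck w = dyck_from 0 w.
Proof.
rewrite -dyck_fromE /dyck add0r; congr (_ && _).
by apply: eq_all => i; rewrite add0r.
Qed.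

Lemma dyck_from_nseq h r w :
  dyck_from h (nseq r D ++ w) = (r <= h) && dyck_from (h - r) w.
Proof.
by elim: r h => [|r IH] [|h] //=; rewrite IH subSS.
Qed.

(** A descent from [h] to the axis has [h] more down steps than up steps; at [h = 0] the semilength
    is thus the number of up steps. *)
Lemma dyck_from_size h w : dyck_from h w -> size w = (count id w).*2 + h.
Proof.
elim: w h => [|[] w IH] h /=; first by move/eqP->.
  by move/IH->; lia.
by case: h => // h /IH->; lia.
Qed.

Lemma nb_UU_cons b w : nb_UU (b :: w) = (b && head D w) + nb_UU w.
Proof.
case: w => [|b' w]; first by rewrite andbF.
rewrite /nb_UU [(size _).-1]/= [(size (b' :: w)).-1]/=.
have ->: iota 0 (size w).+1 = 0 :: [seq i.+1 | i <- iota 0 (size w)].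
  by rewrite -(iotaDl 1).
by rewrite [count _ _]/= count_map !eqb_id.
Qed.

Lemma nb_UU_nseq r w : nb_UU (nseq r D ++ w) = nb_UU w.
Proof. by elim: r => //= r IH; rewrite nb_UU_cons IH. Qed.

Lemma descents_from_nseq r m w :
  descents_from r (nseq m D ++ w) = descents_from (r + m) w.
Proof. by elim: m r => [|m IH] r /=; rewrite ?addn0 // IH addSnnS. Qed.

Lemma descents_from_nil r w :
  descents_from r w = [::] -> r = 0 /\ forall h, dyck_from h w -> w = [::].
Proof.
elim: w r => [|[] w IH] r /=; first by case: r.
  case: r => //= /IH[_ Hw]; split=> // h /[dup] /Hw ->.
  by [].
by move/IH => [].
Qed.

(** * The bijection between words and labelled paths *)

Fixpoint path_of (h : nat) (s : seq block) : seq bool :=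
  match s with
  | [::] => U :: nseq h.+1 D
  | None :: s' => U :: path_of h.+1 s'
  | Some c :: s' => U :: nseq (sumn c).+1 D ++ path_of (h - sumn c) s'
  end.

Lemma head_path_of h s : head D (path_of h s) = U.
Proof. by case: s => [|[c|] s]. Qed.

Lemma dyck_from_path_of p h s : valid_word p h s -> dyck_from h (path_of h s).
Proof.
elim: s h => [|[c|] s IH] h /=.
- by move=> _; rewrite -[nseq h D]cats0 dyck_from_nseq leqnn subnn.
- by case/and3P=> _ le_ch /IH; rewrite dyck_from_nseq le_ch.
- exact: IH.
Qed.

Lemma count_path_of h s : count id (path_of h s) = (size s).+1.
Proof.
elim: s h => [|[c|] s IH] h /=; last by rewrite IH.
  by rewrite count_nseq mul0n.
by rewrite count_cat count_nseq IH mul0n.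
Qed.

Lemma nb_UU_path_of h s : nb_UU (path_of h s) = count_mem None s.
Proof.
elim: s h => [|[c|] s IH] h /=; rewrite nb_UU_cons.
- by rewrite -[D :: nseq h D]/(nseq h.+1 D) -[nseq _ _]cats0 nb_UU_nseq.
- by rewrite -[D :: _ ++ _]/(nseq (sumn c).+1 D ++ _) nb_UU_nseq IH.
- by rewrite head_path_of IH.
Qed.

(** Each block starts with an up step, so runs of different blocks never merge; [l] is the run of
    the final, unlabelled block. *)
Lemma descents_path_of h s :
  exists l, descents (path_of h s) =
    rcons [seq (sumn c).+1 | c <- pmap id s] l.
Proof.
elim: s h => [|[c|] s IH] h /=.
- exists h.+1; rewrite /descents /= -[nseq h D]cats0 descents_from_nseq.
  by rewrite add1n.
- have [l Hl] := IH (h - sumn c); exists l; rewrite -Hl /descents /=.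
  rewrite descents_from_nseq add1n.
  by have := head_path_of (h - sumn c) s; case: path_of => [|[] w].
- by have [l Hl] := IH h.+1; exists l; rewrite -Hl.
Qed.

(** The path only remembers the sum of each label, hence the second hypothesis, which also tells a
    labelled block from the final one. *)
Lemma path_of_inj h s s' :
  path_of h s = path_of h s' -> pmap id s = pmap id s' -> s = s'.
Proof.
elim: s h s' => [|[c|] s IH] h [|[c'|] s'] //=.
- by have := head_path_of h.+1 s'; case: path_of => [|[] w].
- move=> [Ew] [Ec Es]; rewrite -{}Ec in Ew *; congr (_ :: _).
  by apply: IH Es; move/eqP: Ew; rewrite eqseq_cat // eqxx => /eqP; apply.
- by have := head_path_of h.+1 s'; case: path_of => [|[] w].
- by have := head_path_of h.+1 s; case: path_of => [|[] w].
- by have := head_path_of h.+1 s; case: path_of => [|[] w].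
- by move=> [Ew] Es; congr (_ :: _); apply: IH Ew Es.
Qed.

Lemma labels_path_of p h s : valid_word p h s ->
  all2 (fun l c => composition l.-1 p c)
    (take (size (descents (path_of h s))).-1 (descents (path_of h s)))
    (pmap id s).
Proof.
have [l ->] := descents_path_of h s.
rewrite size_rcons -cats1 take_size_cat //.
elim: s h => [|[c|] s IH] h //=; last exact: IH.
by case/and3P=> szc _ /IH ->; rewrite /composition szc eqxx.
Qed.

Lemma split_run (w : seq bool) :
  exists r w', w = nseq r D ++ w' /\ (w' = [::] \/ exists w'', w' = U :: w'').
Proof.
elim: w => [|[] w [r [w' [-> Hw']]]]; first by exists 0, [::]; split; auto.
  by exists 0, (U :: nseq r D ++ w'); split=> //; right; exists (nseq r D ++ w').
by exists r.+1, w'.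
Qed.

(** Strong induction on the size, since each round removes a whole run of down steps: an empty run
    gives [None], a run up to the end of the path gives the final block, any other run takes the
    next label. *)
Lemma path_of_onto p h w L :
    dyck_from h (U :: w) ->
    all2 (fun l c => composition l.-1 p c)
      (take (size (descents (U :: w))).-1 (descents (U :: w))) L ->
  exists s, [/\ valid_word p h s, path_of h s = U :: w & pmap id s = L].
Proof.
have [m] := ubnP (size w); elim: m w h L => // m IH w h L.
have [r [w' [-> [->|[w'' ->]]]]] := split_run w; rewrite size_cat size_nseq.
  rewrite [dyck_from _ _]/= dyck_from_nseq /= /descents /= descents_from_nseq.
  rewrite add0n cats0 => _ /andP[ler /eqP Er].
  have {ler Er} -> : r = h.+1 by lia.
  by case: L => // _; exists [::].
rewrite /= ltnS => ltm; rewrite dyck_from_nseq => /andP[ler dw''].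
rewrite /descents /= descents_from_nseq add0n.
case: r => [|r] in ltm ler dw'' *.
  case/(IH w'' h.+1 L); [by lia|by []|] => s [Hs Ew EL].
  by exists (None :: s); rewrite /= Ew.
rewrite [descents_from _ (U :: _)]/=; set ds := descents_from 0 w''.
(* The path continues with an up step and must return to the axis, so the run just read is not the
   last descent and [L] has a label for it. *)
have ds_neq0 : ds != [::].
  apply/eqP => Eds.
  have [_ Hw] := @descents_from_nil 0 (U :: w'') Eds.
  by have := Hw _ dw''.
case: L => [|c L]; first by case: ds ds_neq0.
case Eds: ds ds_neq0 => [//|l ds'] _ /=.
case/andP=> /andP[szc /eqP sc] HL.
rewrite subSS in dw''.
have [||s [Hs Ew EL]] := IH w'' (h - r) L _ dw''; first by lia.
  by rewrite /descents [descents_from _ _]/= -/ds Eds; move: HL.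
exists (Some c :: s); rewrite /= sc szc Ew EL; split=> //.
by rewrite -ltnS ler.
Qed.

(** * Transfer of the count to labelled paths *)

Local Open Scope ring_scope.

Theorem theorem4p3 (d n k : nat) (hd : (2 <= d)%N) :
  exists2 A : {fset labelled_path},
    (forall p : labelled_path,
        p \in A <->
        [/\ Qtilde d p, semilength p.1 = n.+1 & nb_UU p.1 = k])
    & Nnum d n k = #|` A |%:R.
Proof.
have p_gt0 : (0 < d.-1)%N by lia.
(* [rev] restores the reading order of the stored words; [pmap id] drops each [None] and keeps the
   labels. *)
pose phi (t : seq block) := (path_of 0 (rev t), pmap id (rev t)).
pose ws := [seq t | e <- iota 0 k.+1, t <- words d.-1 n k e].
have mem_ws t : t \in ws <->
    [/\ size t = n, count_mem None t = k & valid_word d.-1 0 (rev t)].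
  split=> [/allpairsPdep[e [t' [_ + ->]]]|[szt ct]].
    rewrite mem_words => /and3P[/eqP-> /eqP-> He]; split=> //.
    by apply/valid_wordP; exists e; rewrite revK.
  case/valid_wordP=> e; rewrite revK => He.
  apply/allpairsPdep; exists e, t; split=> //; last first.
    by rewrite mem_words szt ct !eqxx.
  by rewrite mem_iota ltnS -ct (rev_word_le He).
have ws_uniq : uniq ws.
  apply: allpairs_uniq_dep => [|e _|]; [exact: iota_uniq|exact: words_uniq|].
  move=> [e t] [e' t'] /allpairsPdep[e1 [t1 [_ + [Ee Et]]]].
  rewrite {}Ee {}Et mem_words => /and3P[_ _ He].
  move=> /allpairsPdep[e2 [t2 [_ + [Ee Et]]]].
  rewrite {}Ee {}Et mem_words => /and3P[_ _ He'] /= E.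
  by rewrite -{}E in He' *; rewrite (rev_word_inj He He').
have phi_inj : injective phi.
  by move=> t t' [/path_of_inj E /E]; apply: (can_inj revK).
exists [fset x in [seq phi t | t <- ws]]%fset.
  move=> [w L]; rewrite in_fset; split=> [/mapP[t /mem_ws[szt ct vt] [-> ->]]|].
    have dt := dyck_from_path_of vt.
    split; last by rewrite nb_UU_path_of count_rev.
      rewrite /Qtilde dyckE dt labels_path_of // andbT.
      by have := head_path_of 0 (rev t); case: path_of.
    rewrite /semilength (dyck_from_size dt) addn0 doubleK count_path_of.
    by rewrite size_rev szt.
  case=> /and3P[/=]; rewrite dyckE; case: w => [//|[] w] // _ dw HL semi nUU.
  have [s [vs Ew EL]] := path_of_onto dw HL.
  apply/mapP; exists (rev s); last by rewrite /phi revK Ew EL.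
  apply/mem_ws; rewrite size_rev count_rev revK; split=> //.
    apply/succn_inj; rewrite -semi -(count_path_of 0) Ew /semilength.
    by rewrite (dyck_from_size dw) addn0 doubleK.
  by rewrite -(nb_UU_path_of 0) Ew.
rewrite card_fseq undup_id ?map_inj_uniq // size_map.
have H : (n.+1 * size ws)%N =
    ('C(n.+1, k.+1) * 'C(n + (n - k) * (d - 2) + 1, k))%N.
  rewrite size_allpairs_sum -[iota 0 _]/(index_iota 0 k.+1) big_mkord.
  rewrite big_distrr /=.
  have [le_kn|lt_nk] := leqP k n; last first.
    rewrite ['C(n.+1, _)]bin_small // mul0n big1 // => e _.
    by rewrite size_words // bin_small // muln0; case: ifP.
  (* As [k <= n], the upper index is [2 + (n-k)(d-1) + k - 1]. The summand 2 accounts for the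
     weights [e + 1], which are [ncomp 2 e]. *)
  have ->: 'C(n + (n - k) * (d - 2) + 1, k) = ncomp (2 + (n - k) * d.-1) k.
    rewrite /ncomp; congr 'C(_, _).
    have [d' ->] : exists d', d = d'.+2 by exists d.-2; lia.
    by rewrite !subSS subn0 /= mulnS; lia.
  rewrite -ncomp_conv big_distrr /=; apply: eq_bigr => e _.
  by rewrite size_words // -ltnS ltn_ord ncomp2; ring.
rewrite /Nnum -mulrA -natrM -H natrM mulKf //.
by rewrite pnatr_eq0.
Qed.
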